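(* Let $\mathcal{Q}$ be a small quantaloid and let $\Phi\colon(X,\alpha)\to(Y,\beta)$ be a left adjoint distributor between $\mathcal{Q}$-categories, with right adjoint distributor $\Psi\colon(Y,\beta)\to(X,\alpha)$. Then $\Phi$ is an extremal monomorphism in $\mathcal{Q}\text{-}\mathtt{Set}$ if and only if $$\Psi(x_1,y)\circ\Phi(y,x_2)\le\alpha(x_1,x_2),\qquad x_1,x_2\in X_0,\ y\in Y_0.$$
   Context: A small quantaloid $\mathcal{Q}$ is a small category (object set $\mathcal{Q}_0$, set of all morphisms $\mathrm{morph}(\mathcal{Q})$, identities $1_p$) in which each $\hom(p,q)$ is a complete lattice and composition $\circ\colon\hom(q,r)\times\hom(p,q)\to\hom(p,r)$ preserves arbitrary joins in each variable. A typed set is a set $X_0$ with a map $|\cdot|\colon X_0\to\mathcal{Q}_0$. A $\mathcal{Q}$-category $(X,\alpha)$ is a typed set $X$ with $\alpha\colon X_0\times X_0\to\mathrm{morph}(\mathcal{Q})$ such that $\alpha(x,y)\in\hom(|y|,|x|)$, $\alpha(x,y)\circ\alpha(y,z)\le\alpha(x,z)$ and $1_{|x|}\le\alpha(x,x)$. A distributor $\Phi$ from $(X,\alpha)$ to $(Y,\beta)$ is a map $\Phi\colon Y_0\times X_0\to\mathrm{morph}(\mathcal{Q})$ with $\Phi(y,x)\in\hom(|x|,|y|)$, $\beta(y_1,y_2)\circ\Phi(y_2,x)\le\Phi(y_1,x)$ and $\Phi(y,x_1)\circ\alpha(x_1,x_2)\le\Phi(y,x_2)$. The composite of $\Phi$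 from $(X,\alpha)$ to $(Y,\beta)$ with $\Psi$ from $(Y,\beta)$ to $(Z,\gamma)$ is $(\Psi\otimes\Phi)(z,x)=\bigvee_{y\in Y_0}\Psi(z,y)\circ\Phi(y,x)$; the identity distributor on $(X,\alpha)$ is $\alpha$. A distributor $\Phi$ from $(X,\alpha)$ to $(Y,\beta)$ is left adjoint to a distributor $\Psi$ from $(Y,\beta)$ to $(X,\alpha)$, written $\Phi\dashv\Psi$, if $\alpha\le\Psi\otimes\Phi$ and $\Phi\otimes\Psi\le\beta$ pointwise; $\Psi$ is then uniquely determined by $\Phi$. $\mathcal{Q}\text{-}\mathtt{Set}$ is the category whose objects are $\mathcal{Q}$-categories and whose morphisms are left adjoint distributors, with composition $\otimes$. A monomorphism $m$ in a category is extremal if, whenever $m=f\circ e$ with $e$ an epimorphism, $e$ is an isomorphism. *)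

(* Defs.v *)
From mathcomp Require Import all_boot all_order.
From mathcomp Require Import boolp classical_sets.

Set Implicit Arguments.
Unset Strict Implicit.
Unset Printing Implicit Defensive.

Import Order.TTheory.
Local Open Scope classical_set_scope.
Local Open Scope order_scope.

Reserved Notation "g \c f" (at level 50, left associativity).
Reserved Notation "Psi \ot Phi" (at level 50, left associativity).
Reserved Notation "Phi -| Psi" (at level 70, no associativity).

Record category := Category {
  obj :> Type;
  mor : obj -> obj -> Type;
  idm : forall X, mor X X;
  comp : forall X Y Z, mor Y Z -> mor X Y -> mor X Z;
  compA : forall W X Y Z (h : mor Y Z) (g : mor X Y) (f : mor W X),
    comp h (comp g f) = comp (comp h g) f;
  comp1m : forall X Y (f : mor X Y), comp (idm Y) f = f;
  compm1 : forall X Y (f : mor X Y), comp f (idm X) = f }.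

Section Morphisms.
Context {C : category}.

Definition mono (X Y : C) (m : mor X Y) : Prop :=
  forall (W : C) (u v : mor W X), comp m u = comp m v -> u = v.

Definition epi (X Y : C) (e : mor X Y) : Prop :=
  forall (Z : C) (u v : mor Y Z), comp u e = comp v e -> u = v.

Definition iso (X Y : C) (e : mor X Y) : Prop :=
  exists g : mor Y X, comp g e = idm X /\ comp e g = idm Y.

Definition extremal_mono (X Y : C) (m : mor X Y) : Prop :=
  mono m /\
  forall (Z : C) (e : mor X Z) (f : mor Z Y), m = comp f e -> epi e -> iso e.

End Morphisms.

(* Completeness of the hom-posets is given by suprema of arbitrary subsets,
   the empty one included; [join] is determined by [joinP] since the order is
   antisymmetric. *)
Record quantaloid (d : Order.disp_t) := Quantaloid {
  qobj :> Type;
  hom : qobj -> qobj -> porderType d;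
  qid : forall p, hom p p;
  qcomp : forall p q r, hom q r -> hom p q -> hom p r;
  qcompA : forall p q r s (h : hom r s) (g : hom q r) (f : hom p q),
    qcomp h (qcomp g f) = qcomp (qcomp h g) f;
  qcomp1m : forall p q (f : hom p q), qcomp (qid q) f = f;
  qcompm1 : forall p q (f : hom p q), qcomp f (qid p) = f;
  join : forall p q, set (hom p q) -> hom p q;
  joinP : forall p q (A : set (hom p q)), supremums A (join A);
  qcomp_joinl : forall p q r (A : set (hom q r)) (f : hom p q),
    qcomp (join A) f = join [set qcomp g f | g in A];
  qcomp_joinr : forall p q r (g : hom q r) (A : set (hom p q)),
    qcomp g (join A) = join [set qcomp g f | f in A] }.

Notation "g \c f" := (qcomp g f) : order_scope.

Section QuantaloidTheory.
Context {d : Order.disp_t} {Q : quantaloid d}.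

Lemma join_ub (p q : Q) (A : set (hom p q)) f : A f -> f <= join A.
Proof. by have [ub _] := joinP A; exact: ub. Qed.

Lemma join_le (p q : Q) (A : set (hom p q)) f :
  (forall g, A g -> g <= f) -> join A <= f.
Proof. by have [_ lub] := joinP A; exact: lub. Qed.

Lemma qcomp_lel (p q r : Q) (g g' : hom q r) (f : hom p q) :
  g <= g' -> g \c f <= g' \c f.
Proof.
move=> gg'; have <- : join [set g; g'] = g'.
  apply/le_anti/andP; split; first by apply: join_le => _ [->|->].
  by apply: join_ub; right.
by rewrite qcomp_joinl; apply: join_ub; exists g => //; left.
Qed.

Lemma qcomp_ler (p q r : Q) (g : hom q r) (f f' : hom p q) :
  f <= f' -> g \c f <= g \c f'.
Proof.
move=> ff'; have <- : join [set f; f'] = f'.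
  apply/le_anti/andP; split; first by apply: join_le => _ [->|->].
  by apply: join_ub; right.
by rewrite qcomp_joinr; apply: join_ub; exists f => //; left.
Qed.

Lemma qcomp_le (p q r : Q) (g g' : hom q r) (f f' : hom p q) :
  g <= g' -> f <= f' -> g \c f <= g' \c f'.
Proof. by move=> gg' ff'; apply: le_trans (qcomp_lel _ gg') (qcomp_ler _ ff'). Qed.

End QuantaloidTheory.

(* [ty x] is the type |x|, and [qhom x y] is alpha(x, y). *)
Record qcat (d : Order.disp_t) (Q : quantaloid d) := QCat {
  carrier :> Type;
  ty : carrier -> Q;
  qhom : forall x y : carrier, hom (ty y) (ty x);
  qhom_trans : forall x y z, qhom x y \c qhom y z <= qhom x z;
  qhom_refl : forall x, qid (ty x) <= qhom x x }.

Record distributor (d : Order.disp_t) (Q : quantaloid d) (X Y : qcat Q) :=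
  Distributor {
    dist :> forall (y : Y) (x : X), hom (ty x) (ty y);
    dist_actl : forall y1 y2 x, qhom y1 y2 \c dist y2 x <= dist y1 x;
    dist_actr : forall y x1 x2, dist y x1 \c qhom x1 x2 <= dist y x2 }.

Section Distributors.
Context {d : Order.disp_t} {Q : quantaloid d}.
Implicit Types X Y Z : qcat Q.

Lemma dist_eq X Y (Phi Phi' : distributor X Y) :
  (forall y x, Phi y x = Phi' y x) -> Phi = Phi'.
Proof.
case: Phi Phi' => [f fl fr] [g gl gr] /= fg.
have {}fg : f = g.
  apply: functional_extensionality_dep => y.
  by apply: functional_extensionality_dep.
by subst g; congr Distributor; exact: Prop_irrelevance.
Qed.

Definition dcomp_fun X Y Z (Psi : distributor Y Z) (Phi : distributor X Y)
    (z : Z) (x : X) : hom (ty x) (ty z) :=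
  join [set Psi z y \c Phi y x | y in [set: Y]].

Lemma dcomp_ub X Y Z (Psi : distributor Y Z) (Phi : distributor X Y) y z x :
  Psi z y \c Phi y x <= dcomp_fun Psi Phi z x.
Proof. by apply: join_ub; exists y. Qed.

Lemma dcomp_le X Y Z (Psi : distributor Y Z) (Phi : distributor X Y) z x f :
  (forall y, Psi z y \c Phi y x <= f) -> dcomp_fun Psi Phi z x <= f.
Proof. by move=> le_f; apply: join_le => _ [y _ <-]. Qed.

Lemma qcomp_dcomp_le X Y Z (Psi : distributor Y Z) (Phi : distributor X Y)
    z x q (h : hom (ty z) q) f :
  (forall y, h \c Psi z y \c Phi y x <= f) -> h \c dcomp_fun Psi Phi z x <= f.
Proof.
move=> le_f; rewrite qcomp_joinr; apply: join_le => _ [_ [y _ <-] <-].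
by rewrite qcompA.
Qed.

Lemma dcomp_qcomp_le X Y Z (Psi : distributor Y Z) (Phi : distributor X Y)
    z x p (h : hom p (ty x)) f :
  (forall y, Psi z y \c (Phi y x \c h) <= f) -> dcomp_fun Psi Phi z x \c h <= f.
Proof.
move=> le_f; rewrite qcomp_joinl; apply: join_le => _ [_ [y _ <-] <-].
by rewrite -qcompA.
Qed.

Lemma dcomp_actl X Y Z (Psi : distributor Y Z) (Phi : distributor X Y) z1 z2 x :
  qhom z1 z2 \c dcomp_fun Psi Phi z2 x <= dcomp_fun Psi Phi z1 x.
Proof.
apply: qcomp_dcomp_le => y; apply: le_trans (dcomp_ub _ _ y _ _).
exact/qcomp_lel/dist_actl.
Qed.

Lemma dcomp_actr X Y Z (Psi : distributor Y Z) (Phi : distributor X Y) z x1 x2 :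
  dcomp_fun Psi Phi z x1 \c qhom x1 x2 <= dcomp_fun Psi Phi z x2.
Proof.
apply: dcomp_qcomp_le => y; apply: le_trans (dcomp_ub _ _ y _ _).
exact/qcomp_ler/dist_actr.
Qed.

Definition dcomp X Y Z (Psi : distributor Y Z) (Phi : distributor X Y) :
    distributor X Z :=
  Distributor (dcomp_actl Psi Phi) (dcomp_actr Psi Phi).

Definition did X : distributor X X :=
  @Distributor d Q X X (@qhom d Q X) (@qhom_trans d Q X) (@qhom_trans d Q X).

Definition left_adjoint X Y (Phi : distributor X Y) (Psi : distributor Y X) :
    Prop :=
  (forall x1 x2 : X, qhom x1 x2 <= dcomp Psi Phi x1 x2) /\
  (forall y1 y2 : Y, dcomp Phi Psi y1 y2 <= qhom y1 y2).

End Distributors.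

Notation "Psi \ot Phi" := (dcomp Psi Phi) : order_scope.
Notation "Phi -| Psi" := (left_adjoint Phi Psi) : order_scope.

Section QSet.
Context {d : Order.disp_t} (Q : quantaloid d).
Implicit Types W X Y Z : qcat Q.

Lemma dcompA W X Y Z (Xi : distributor Y Z) (Psi : distributor X Y)
    (Phi : distributor W X) : Xi \ot (Psi \ot Phi) = (Xi \ot Psi) \ot Phi.
Proof.
apply: dist_eq => z w; apply/le_anti/andP; split; apply: dcomp_le.
  move=> y; apply: qcomp_dcomp_le => x.
  exact/(le_trans _ (dcomp_ub _ _ x _ _))/qcomp_lel/dcomp_ub.
move=> x; apply: dcomp_qcomp_le => y.
exact/(le_trans _ (dcomp_ub _ _ y _ _))/qcomp_ler/dcomp_ub.
Qed.

Lemma dcomp1m X Y (Phi : distributor X Y) : did Y \ot Phi = Phi.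
Proof.
apply: dist_eq => y x; apply/le_anti/andP; split.
  by apply: dcomp_le => y'; exact: dist_actl.
apply: le_trans (dcomp_ub _ _ y _ _).
by rewrite -[leLHS]qcomp1m; apply/qcomp_lel/qhom_refl.
Qed.

Lemma dcompm1 X Y (Phi : distributor X Y) : Phi \ot did X = Phi.
Proof.
apply: dist_eq => y x; apply/le_anti/andP; split.
  by apply: dcomp_le => x'; exact: dist_actr.
apply: le_trans (dcomp_ub _ _ x _ _).
by rewrite -[leLHS]qcompm1; apply/qcomp_ler/qhom_refl.
Qed.

Lemma left_adjoint_id X : did X -| did X.
Proof. by split=> x y; rewrite dcomp1m. Qed.

Lemma left_adjoint_comp X Y Z (Phi : distributor X Y) (Phi' : distributor Y X)
    (Psi : distributor Y Z) (Psi' : distributor Z Y) :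
  Phi -| Phi' -> Psi -| Psi' -> Psi \ot Phi -| Phi' \ot Psi'.
Proof.
move=> [u1 c1] [u2 c2]; split=> [x1 x2|z1 z2].
  apply: le_trans (u1 x1 x2) _; rewrite -dcompA (dcompA Psi').
  apply: dcomp_le => y; apply: le_trans (dcomp_ub _ _ y _ _).
  apply: qcomp_ler; rewrite -[Phi in leLHS]dcomp1m.
  apply: dcomp_le => y'; apply: le_trans (dcomp_ub _ _ y' _ _).
  exact/qcomp_lel/u2.
apply: le_trans (c2 z1 z2); rewrite -dcompA (dcompA Phi).
apply: dcomp_le => y; apply: le_trans (dcomp_ub _ _ y _ _).
apply: qcomp_ler; rewrite -[Psi' in leRHS]dcomp1m.
apply: dcomp_le => y'; apply: le_trans (dcomp_ub _ _ y' _ _).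
exact/qcomp_lel/c1.
Qed.

Definition ladist X Y :=
  {Phi : distributor X Y | exists Psi : distributor Y X, Phi -| Psi}.

Definition ladist_of X Y (Phi : distributor X Y) (Psi : distributor Y X)
    (PhiPsi : Phi -| Psi) : ladist X Y :=
  exist _ Phi (ex_intro _ Psi PhiPsi).

Lemma ladist_eq X Y (F G : ladist X Y) : sval F = sval G -> F = G.
Proof.
case: F G => [Phi adjPhi] [Psi adjPsi] /= eqPhi.
by subst Psi; congr exist; exact: Prop_irrelevance.
Qed.

Definition ladist_id X : ladist X X := ladist_of (left_adjoint_id X).

Lemma ladist_comp_subproof X Y Z (G : ladist Y Z) (F : ladist X Y) :
  exists Psi : distributor Z X, sval G \ot sval F -| Psi.
Proof.
case: G F => [Psi [Psi' adjPsi]] [Phi [Phi' adjPhi]].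
by exists (Phi' \ot Psi'); exact: left_adjoint_comp.
Qed.

Definition ladist_comp X Y Z (G : ladist Y Z) (F : ladist X Y) : ladist X Z :=
  exist _ (sval G \ot sval F) (ladist_comp_subproof G F).

Lemma ladist_compA W X Y Z (H : ladist Y Z) (G : ladist X Y) (F : ladist W X) :
  ladist_comp H (ladist_comp G F) = ladist_comp (ladist_comp H G) F.
Proof. exact/ladist_eq/dcompA. Qed.

Lemma ladist_comp1m X Y (F : ladist X Y) : ladist_comp (ladist_id Y) F = F.
Proof. exact/ladist_eq/dcomp1m. Qed.

Lemma ladist_compm1 X Y (F : ladist X Y) : ladist_comp F (ladist_id X) = F.
Proof. exact/ladist_eq/dcompm1. Qed.

Definition QSet : category :=
  Category ladist_compA ladist_comp1m ladist_compm1.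

End QSet.

(* Main.v *)
Require Import Defs.
From mathcomp Require Import all_boot all_order.

(** The inequality says that the unit of the adjunction [Phi -| Psi] is an
    equality, [Psi \ot Phi = did X]; in functorial terms, that [Phi] is fully
    faithful.  The theorem then comes from the factorization of left adjoint
    distributors into epimorphisms followed by fully faithful ones.

    The epimorphisms are the left adjoints [E -| E'] whose counit is an
    equality.  If [E \ot E' = did Z], then [E] can be cancelled by composing
    with [E'].  Conversely, glue two copies of [Z] by letting [E \ot E'] be the
    hom between different copies.  Since [E \ot E' \ot E = E], the two
    inclusions of [Z] agree after composition with [E]; if [E] is an
    epimorphism they coincide, and comparing their values gives
    [did Z = E \ot E'] ([epi_counit]).

    If the unit of [Phi -| Psi] is an equality and [Phi = F \ot E] with [E] an
    epimorphism, then [Phi] is a monomorphism because [Psi] cancels it, and the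
    unit of [E -| E'] is squeezed between [did X] and [Psi \ot Phi], so it is
    an equality as well.  The counit of [E -| E'] being an equality too, [E'] is
    an inverse of [E] ([unit_eq_cancel], [iso_unit_counit]).

    Conversely, [Psi \ot Phi] is a hom on the typed set of [X], and [Phi]
    factors through the Q-category it defines ([image]) by way of an
    epimorphism.  If [Phi] is extremal, this epimorphism is invertible, so its
    composite with its right adjoint is [did X]; but this composite is
    [Psi \ot Phi] ([image_factor], [to_image_epi], [monad_idem]). *)

Set Implicit Arguments.
Unset Strict Implicit.
Unset Printing Implicit Defensive.

Import Order.TTheory.
Local Open Scope order_scope.

Reserved Notation "Phi <=d Psi" (at level 70, no associativity).

(** * The pointwise order of distributors *)

Section PointwiseOrder.
Context {d : Order.disp_t} {Q : quantaloid d}.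
Implicit Types X Y Z : qcat Q.

Definition dist_le X Y (Phi Phi' : distributor X Y) : Prop :=
  forall y x, Phi y x <= Phi' y x.

Notation "Phi <=d Psi" := (dist_le Phi Psi) : order_scope.

Lemma dist_lexx X Y (Phi : distributor X Y) : Phi <=d Phi.
Proof. by move=> y x. Qed.

Lemma dist_le_trans X Y (Phi2 Phi1 Phi3 : distributor X Y) :
  Phi1 <=d Phi2 -> Phi2 <=d Phi3 -> Phi1 <=d Phi3.
Proof. by move=> le12 le23 y x; apply: le_trans (le12 y x) (le23 y x). Qed.

Lemma dist_le_anti X Y (Phi Phi' : distributor X Y) :
  Phi <=d Phi' -> Phi' <=d Phi -> Phi = Phi'.
Proof.
by move=> le1 le2; apply: dist_eq => y x; apply/le_anti; rewrite le1 le2.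
Qed.

Lemma dcomp_mono X Y Z (Psi Psi' : distributor Y Z) (Phi Phi' : distributor X Y) :
  Psi <=d Psi' -> Phi <=d Phi' -> Psi \ot Phi <=d Psi' \ot Phi'.
Proof.
move=> lePsi lePhi z x; apply: dcomp_le => y.
exact: le_trans (qcomp_le (lePsi z y) (lePhi y x)) (dcomp_ub _ _ y _ _).
Qed.

End PointwiseOrder.

Notation "Phi <=d Psi" := (dist_le Phi Psi) : order_scope.

(** * Adjunctions of distributors *)

Section Adjunctions.
Context {d : Order.disp_t} {Q : quantaloid d}.
Implicit Types X Y Z : qcat Q.

Lemma adj_unit X Y (Phi : distributor X Y) (Psi : distributor Y X) :
  Phi -| Psi -> did X <=d Psi \ot Phi.
Proof. by case. Qed.

Lemma adj_counit X Y (Phi : distributor X Y) (Psi : distributor Y X) :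
  Phi -| Psi -> Phi \ot Psi <=d did Y.
Proof. by case. Qed.

Lemma adj_triangle X Y (Phi : distributor X Y) (Psi : distributor Y X) :
  Phi -| Psi -> (Phi \ot Psi) \ot Phi = Phi.
Proof.
move=> adj; apply: dist_le_anti.
  rewrite -[X in _ <=d X]dcomp1m.
  exact: dcomp_mono (adj_counit adj) (dist_lexx _).
rewrite -[X in X <=d _]dcompm1 -dcompA.
exact: dcomp_mono (dist_lexx _) (adj_unit adj).
Qed.

Lemma adj_triangle_right X Y (Phi : distributor X Y) (Psi : distributor Y X) :
  Phi -| Psi -> (Psi \ot Phi) \ot Psi = Psi.
Proof.
move=> adj; apply: dist_le_anti.
  rewrite -[X in _ <=d X]dcompm1 -dcompA.
  exact: dcomp_mono (dist_lexx _) (adj_counit adj).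
rewrite -[X in X <=d _]dcomp1m.
exact: dcomp_mono (adj_unit adj) (dist_lexx _).
Qed.

Lemma right_adjoint_le X Y (Phi : distributor X Y) (Psi Psi' : distributor Y X) :
  Phi -| Psi -> Phi -| Psi' -> Psi <=d Psi'.
Proof.
move=> adj adj'; rewrite -[Psi]dcomp1m -[Psi']dcompm1.
apply: (@dist_le_trans _ _ _ _ ((Psi' \ot Phi) \ot Psi)).
  exact: dcomp_mono (adj_unit adj') (dist_lexx _).
by rewrite -dcompA; exact: dcomp_mono (dist_lexx _) (adj_counit adj).
Qed.

Lemma unit_eqP X Y (Phi : distributor X Y) (Psi : distributor Y X) :
  Phi -| Psi ->
  (forall x1 x2 y, Psi x1 y \c Phi y x2 <= qhom x1 x2) <->
  Psi \ot Phi = did X.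
Proof.
move=> adj; split=> [le1 | eq1 x1 x2 y].
  apply: dist_le_anti; last exact: adj_unit.
  by move=> x1 x2; apply: dcomp_le => y; exact: le1.
by rewrite -[leRHS]/(did X x1 x2) -eq1; exact: dcomp_ub.
Qed.

(** If the composite adjunction [F \ot E -| Psi] has an invertible unit then so
    has [E -| E'], because [E' \ot E] embeds in [Psi \ot (F \ot E)] through the
    unit of [F]. *)
Lemma unit_eq_cancel X Y Z (E : distributor X Z) (E' : distributor Z X)
    (F : distributor Z Y) (F' : distributor Y Z) (Psi : distributor Y X) :
  E -| E' -> F -| F' -> F \ot E -| Psi -> Psi \ot (F \ot E) = did X ->
  E' \ot E = did X.
Proof.
move=> adjE adjF adj eq1; apply: dist_le_anti; last exact: adj_unit.
rewrite -eq1.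
apply: (@dist_le_trans _ _ _ _ ((E' \ot F') \ot (F \ot E))); last first.
  apply: dcomp_mono (dist_lexx _).
  exact: right_adjoint_le (left_adjoint_comp adjE adjF) adj.
rewrite -dcompA (dcompA F'); apply: dcomp_mono (dist_lexx _) _.
rewrite -[X in X <=d _]dcomp1m.
exact: dcomp_mono (adj_unit adjF) (dist_lexx _).
Qed.

End Adjunctions.

(** * Two copies of a Q-category glued along a distributor *)

Section Double.
Context {d : Order.disp_t} {Q : quantaloid d} (Z : qcat Q).
Variables (e : distributor Z Z) (e_le1 : e <=d did Z).

(** This is a hom for every [e <=d did Z]: identities stay within a copy, a path
    that returns to its copy is bounded by the hom of [Z], and a path that
    changes copy is bounded by an action of [Z] on [e]. *)
Definition double_hom (w1 w2 : bool * Z) : hom (ty w2.2) (ty w1.2) :=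
  if w1.1 == w2.1 then qhom w1.2 w2.2 else e w1.2 w2.2.

Lemma double_hom_le w1 w2 : double_hom w1 w2 <= qhom w1.2 w2.2.
Proof. by rewrite /double_hom; case: ifP => // _; exact: e_le1. Qed.

Lemma double_hom_ge w1 w2 : e w1.2 w2.2 <= double_hom w1 w2.
Proof. by rewrite /double_hom; case: ifP => // _; exact: e_le1. Qed.

Lemma double_hom_trans w1 w2 w3 :
  double_hom w1 w2 \c double_hom w2 w3 <= double_hom w1 w3.
Proof.
have [b13|b13] := eqVneq w1.1 w3.1.
  rewrite {3}/double_hom b13 eqxx.
  apply: le_trans (qcomp_le (double_hom_le _ _) (double_hom_le _ _)) _.
  exact: qhom_trans.
have [b12|b12] := eqVneq w1.1 w2.1.
  rewrite /double_hom b12 eqxx -b12 (negPf b13); exact: dist_actl.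
(* There are only two copies: as the first step leaves the copy of [w1], it ends
   in that of [w3]. *)
have b23 : w2.1 = w3.1.
  by case: (w1.1) (w2.1) (w3.1) b12 b13 => [] [] [].
rewrite /double_hom b23 eqxx (negPf b13); exact: dist_actr.
Qed.

Lemma double_hom_refl w : qid (ty w.2) <= double_hom w w.
Proof. by rewrite /double_hom eqxx; exact: qhom_refl. Qed.

Definition double : qcat Q :=
  @QCat d Q (bool * Z)%type (fun w => ty w.2) double_hom
    double_hom_trans double_hom_refl.

Lemma incl_actr (b : bool) (w : double) (z1 z2 : Z) :
  double_hom w (b, z1) \c qhom z1 z2 <= double_hom w (b, z2).
Proof.
apply: le_trans (double_hom_trans w (b, z1) (b, z2)).
by apply: qcomp_ler; rewrite /double_hom eqxx.
Qed.

Definition incl (b : bool) : distributor Z double :=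
  @Distributor d Q Z double (fun w z => double_hom w (b, z))
    (fun w1 w2 z => double_hom_trans w1 w2 (b, z)) (incl_actr b).

Lemma coincl_actl (b : bool) (z1 z2 : Z) (w : double) :
  qhom z1 z2 \c double_hom (b, z2) w <= double_hom (b, z1) w.
Proof.
apply: le_trans (double_hom_trans (b, z1) (b, z2) w).
by apply: qcomp_lel; rewrite /double_hom eqxx.
Qed.

Definition coincl (b : bool) : distributor double Z :=
  @Distributor d Q double Z (fun z w => double_hom (b, z) w)
    (coincl_actl b) (fun z w1 w2 => double_hom_trans (b, z) w1 w2).

Lemma incl_adj b : incl b -| coincl b.
Proof.
split=> [z1 z2 | w1 w2]; last first.
  by apply: dcomp_le => z; exact: (double_hom_trans w1 (b, z) w2).
apply: le_trans (dcomp_ub _ _ ((b, z1) : double) _ _).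
rewrite -[leLHS]qcomp1m; apply: qcomp_le.
  exact: (double_hom_refl (b, z1)).
by rewrite /= /double_hom eqxx.
Qed.

(** A distributor fixed by [e] does not see the difference between the copies:
    all homs of [double] lie between [e] and the hom of [Z], and both of these
    act trivially on it. *)
Lemma incl_fixed X (E : distributor X Z) b b' :
  e \ot E = E -> incl b \ot E = incl b' \ot E.
Proof.
move=> eE.
suff inclE c : forall w x, (incl c \ot E) w x = E w.2 x.
  by apply: dist_eq => w x; rewrite !inclE.
move=> w x; apply/le_anti/andP; split.
  apply: dcomp_le => z.
  apply: le_trans (qcomp_lel _ (double_hom_le w (c, z))) _.
  exact: dist_actl.
rewrite -{1}eE; apply: dcomp_le => z.
apply: le_trans (dcomp_ub (incl c) _ z w _); apply: qcomp_lel.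
exact: (double_hom_ge w (c, z)).
Qed.

Lemma incl_inj b b' : b != b' -> incl b = incl b' -> e = did Z.
Proof.
move=> neqb eq_incl; apply: dist_eq => z1 z2.
have /= := congr1 (fun I : distributor Z double => I (b, z1) z2) eq_incl.
by rewrite /double_hom /= eqxx (negPf neqb) => ->.
Qed.

End Double.

(** * Epimorphisms and isomorphisms *)

Section EpiIso.
Context {d : Order.disp_t} {Q : quantaloid d}.
Implicit Types X Z : qcat Q.

(** An invertible counit makes [E'] a right inverse of [E].  Conversely, the two
    inclusions of [Z] into the gluing along [E \ot E'] are equalized by [E], by
    the triangle identity, and they differ unless [E \ot E'] is the hom of
    [Z]. *)
Lemma epi_counit X Z (E : distributor X Z) (E' : distributor Z X)
    (adj : E -| E') :
  epi (C := QSet Q) (ladist_of adj) <-> E \ot E' = did Z.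
Proof.
split=> [epiE | eq1 W u v /(congr1 sval) /= uv].
  pose I b : mor (Z : QSet Q) (double (adj_counit adj)) :=
    ladist_of (incl_adj (adj_counit adj) b).
  have eqI : I true = I false.
    by apply: epiE; apply: ladist_eq; apply: incl_fixed; exact: adj_triangle.
  exact: incl_inj (congr1 sval eqI).
apply: ladist_eq; rewrite -[sval u]dcompm1 -[sval v]dcompm1 -eq1 !dcompA.
by rewrite uv.
Qed.

(** The inverse of an isomorphism is a right adjoint of it, so it equals [E']. *)
Lemma iso_unit_counit X Z (E : distributor X Z) (E' : distributor Z X)
    (adj : E -| E') :
  iso (C := QSet Q) (ladist_of adj) <->
  E' \ot E = did X /\ E \ot E' = did Z.
Proof.
split=> [[G [/(congr1 sval) /= GE /(congr1 sval) /= EG]] | [E'E EE']].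
  have adjG : E -| sval G by split=> ? ?; rewrite ?GE ?EG.
  have -> // : E' = sval G.
  by apply: dist_le_anti; apply: right_adjoint_le; eassumption.
have adj' : E' -| E by split=> ? ?; rewrite ?E'E ?EE'.
by exists (ladist_of adj'); split; apply: ladist_eq.
Qed.

End EpiIso.

(** * The image of a left adjoint distributor *)

(** The image keeps the typed set of [X] and enlarges its hom to the monad
    [Psi \ot Phi].  Composites over [X] and over the image are therefore the same
    joins, and the laws of the distributors below are identities between
    distributors on [X]. *)
Section Image.
Context {d : Order.disp_t} {Q : quantaloid d} (X Y : qcat Q).
Variables (Phi : distributor X Y) (Psi : distributor Y X) (adj : Phi -| Psi).

Let a := Psi \ot Phi.

Lemma monad_idem : a \ot a = a.
Proof. by rewrite /a dcompA (adj_triangle_right adj). Qed.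

Lemma image_trans x y z : a x y \c a y z <= a x z.
Proof. by rewrite -{3}monad_idem; exact: (dcomp_ub a a y). Qed.

Lemma image_refl x : qid (ty x) <= a x x.
Proof. exact: le_trans (qhom_refl x) (adj_unit adj x x). Qed.

Definition image : qcat Q :=
  @QCat d Q X (@ty d Q X) a image_trans image_refl.

Definition to_image : distributor X image :=
  @Distributor d Q X image a image_trans (@dist_actr d Q X X a).

Definition of_image : distributor image X :=
  @Distributor d Q image X a (@dist_actl d Q X X a) image_trans.

Lemma to_image_adj : to_image -| of_image.
Proof.
split=> x1 x2.
  by rewrite -[leRHS]/((a \ot a) x1 x2) monad_idem; exact: adj_unit.
by apply: dcomp_le => x; exact: image_trans.
Qed.

Lemma image_in_actr y (x1 x2 : image) : Phi y x1 \c a x1 x2 <= Phi y x2.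
Proof.
rewrite -{2}(adj_triangle adj) -dcompA.
exact: (dcomp_ub Phi a x1).
Qed.

Definition image_in : distributor image Y :=
  @Distributor d Q image Y Phi (@dist_actl d Q X Y Phi) image_in_actr.

Lemma image_out_actl (x1 x2 : image) y : a x1 x2 \c Psi x2 y <= Psi x1 y.
Proof.
rewrite -{2}(adj_triangle_right adj).
exact: (dcomp_ub a Psi x2).
Qed.

Definition image_out : distributor Y image :=
  @Distributor d Q Y image Psi image_out_actl (@dist_actr d Q Y X Psi).

Lemma image_in_adj : image_in -| image_out.
Proof.
by split=> [x1 x2 | y1 y2]; [exact: lexx | exact: (adj_counit adj y1 y2)].
Qed.

Lemma image_factor : Phi = image_in \ot to_image.
Proof. by rewrite -{1}(adj_triangle adj) -dcompA; exact: dist_eq. Qed.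

Lemma to_image_epi : epi (C := QSet Q) (ladist_of to_image_adj).
Proof.
apply/epi_counit; apply: dist_le_anti; first exact: adj_counit to_image_adj.
move=> x1 x2; apply: le_trans (dcomp_ub to_image of_image x1 x1 x2).
by rewrite -[leLHS]qcomp1m; apply/qcomp_lel/image_refl.
Qed.

End Image.

(** * Extremal monomorphisms *)

Theorem theorem5p5 (d : Order.disp_t) (Q : quantaloid d) (X Y : qcat Q)
    (Phi : distributor X Y) (Psi : distributor Y X) (PhiPsi : Phi -| Psi) :
  extremal_mono (C := QSet Q) (ladist_of PhiPsi) <->
  (forall (x1 x2 : X) (y : Y), Psi x1 y \c Phi y x2 <= qhom x1 x2).
Proof.
apply: iff_trans (iff_sym (unit_eqP PhiPsi)); split=> [[_ extremal] | eq1].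
  (* [of_image \ot to_image] is the square of the idempotent [Psi \ot Phi]. *)
  have /iso_unit_counit [<- _] : iso (C := QSet Q)
      (ladist_of (to_image_adj PhiPsi)).
    apply: (extremal _ _ (ladist_of (image_in_adj PhiPsi))).
      exact/ladist_eq/image_factor.
    exact: to_image_epi.
  by rewrite -[LHS](monad_idem PhiPsi); exact: dist_eq.
split=> [W u v /(congr1 sval) /= uv | Z [E [E' adjE]] [F [F' adjF]]].
  apply: ladist_eq; rewrite -[sval u]dcomp1m -[sval v]dcomp1m -eq1 -!dcompA.
  by rewrite uv.
move=> /(congr1 sval) /= PhiFE epiE.
have epiE' : epi (C := QSet Q) (ladist_of adjE) by exact: epiE.
have /epi_counit EE' := epiE'.
suff : iso (C := QSet Q) (ladist_of adjE) by [].
apply/iso_unit_counit; split=> //.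
by apply: (unit_eq_cancel adjE adjF (Psi := Psi)); rewrite -PhiFE.
Qed.
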